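(* Let $\mathcal{S}=\{1,\dots,K\}$ be the state space of a finite Markov decision process, let $\pi$ be a deterministic policy with value function $V_\pi$ whose induced Markov chain is ergodic with steady state distribution $\xi$, and let $\mathcal{F}(1,n_1,\dots,n_{L-1},1)$ be an MLP architecture with network map $f\colon\mathcal{W}\times\mathbb{R}\to\mathbb{R}$ and $N_{net}$ parameters, for which there exists $\mathbf{W}^\circ\in\mathcal{W}$ with $f(\mathbf{W}^\circ,s)=V_\pi(s)$ for all $s\in\mathcal{S}$. Let $\mathcal{J}$ be the Neural Mean Squared Bellman Error. Then the Hessian $\mathsf{H}_{\mathbf{W}}\mathcal{J}(\mathbf{W}^* )\in\mathbb{R}^{N_{net}\times N_{net}}$ of $\mathcal{J}$ at any critical point $\mathbf{W}^*$ of $\mathcal{J}$ is always positive semi-definite. Furthermore, if $N_{net}\ge K$, then its rank is bounded from above by $$\operatorname{rank}\big(\mathsf{H}_{\mathbf{W}}\mathcal{J}(\mathbf{W}^* )\big)\le K.$$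
   Context: MDP: a tuple $(\mathcal{S},\mathcal{A},P,r,\gamma)$ with $\mathcal{S}=\{1,\dots,K\}$, finite action set $\mathcal{A}$, transition probabilities $P(s'|s,a)$, bounded reward $r\colon\mathcal{S}\times\mathcal{A}\times\mathcal{S}\to[-M,M]$ and discount factor $\gamma\in(0,1)$. A deterministic policy is a map $\pi\colon\mathcal{S}\to\mathcal{A}$. Its transition matrix is $P_\pi\in\mathbb{R}^{K\times K}$ with $(P_\pi)_{s,s'}=P(s'|s,\pi(s))$. The Markov chain under $\pi$ is assumed ergodic, with steady state distribution $\xi=(\xi_1,\dots,\xi_K)$, $\xi_i\in(0,1)$; set $\Xi=\operatorname{diag}(\xi_1,\dots,\xi_K)$. The value function is $V_\pi(s)=\lim_{T\to\infty}\mathbb{E}[\sum_{t=0}^T\gamma^t r(s_t,\pi(s_t),s_{t+1})\mid s_0=s]$. The Bellman operator acts on $v\in\mathbb{R}^K$ by $(T_\pi v)_s=\sum_{s'}P(s'|s,\pi(s))\,(r(s,\pi(s),s')+\gamma v_{s'})$. MLP: for $L$ layers with widths $n_0=1,n_1,\dots,n_{L-1},n_L=1$, the parameter space is $\mathcal{W}=\mathbb{R}^{(n_0+1)\times n_1}\times\dots\times\mathbb{R}^{(n_{L-1}+1)\times n_L}$, of dimension $N_{net}=\sum_{l=1}^L(n_{l-1}+1)n_l$, equipped with the Euclidean inner product. For $\mathbf{W}=(W_1,\dots,W_L)$ and input $\phi_0$, define recursively $\phi_l=\sigma_l\!\left(W_l^{\mathsf T}\begin{bmatrix}\phi_{l-1}\\1\end{bmatrix}\right)$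 for $l=1,\dots,L$, and $f(\mathbf{W},\phi_0)=\phi_L$. Here $\sigma_L$ is the identity and, for $l<L$, $\sigma_l=\sigma$ is a fixed activation function $\mathbb{R}\to\mathbb{R}$ applied elementwise, which is smooth, unbounded and strictly monotonically increasing. A discrete state $s\in\{1,\dots,K\}$ is fed to the network as the real number $s$. Loss: with $F(\mathbf{W})=[f(\mathbf{W},1),\dots,f(\mathbf{W},K)]^{\mathsf T}$, the Bellman residual vector is $\Delta_\pi(\mathbf{W})=F(\mathbf{W})-T_\pi F(\mathbf{W})\in\mathbb{R}^K$, and $\mathcal{J}(\mathbf{W})=\frac12\Delta_\pi(\mathbf{W})^{\mathsf T}\,\Xi\,\Delta_\pi(\mathbf{W})$. A critical point of $\mathcal{J}$ is a $\mathbf{W}^*$ with $\nabla_{\mathbf{W}}\mathcal{J}(\mathbf{W}^* )=0$. The Hessian is taken with respect to the vectorised parameters. The paper evaluates it at a critical point as $\mathsf{H}_{\mathbf{W}}\mathcal{J}(\mathbf{W}^* )=G(\mathbf{W}^* )^{\mathsf T}(I_K-\gamma P_\pi)^{\mathsf T}\,\Xi\,(I_K-\gamma P_\pi)G(\mathbf{W}^* )$, where $G(\mathbf{W})\in\mathbb{R}^{K\times N_{net}}$ has as its $s$-th row the vectorised gradient of $\mathbf{W}\mapsto f(\mathbf{W},s)$, i.e. with the term involving second derivatives of $F$, which carries the factor $\Delta_\pi(\mathbf{W}^* )$, taken to vanish at critical points; the paper titles the result ''Properties of the approximated Hessian''.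
   Formalization: The exact Hessian of J can be indefinite at a critical point; semi-definiteness and the rank bound are stated for the approximated Hessian, which omits the term with second derivatives of f weighted by the Bellman residual, and the exact Hessian is shown to equal the sum of the two. *)

(* Defs.v *)
From HB Require Import structures.
From mathcomp Require Import all_boot all_order all_algebra.
From mathcomp Require Import all_classical all_reals all_analysis.
Set Implicit Arguments.
Unset Strict Implicit.
Unset Printing Implicit Defensive.
Import Order.TTheory GRing.Theory Num.Theory.
Import numFieldNormedType.Exports.
Local Open Scope classical_set_scope.
Local Open Scope ring_scope.

(* The state s in {1, .., K} is represented by the ordinal s - 1 : 'I_K. *)
Record mdp (R : realType) (K : nat) (A : finType) := Mdp {
  trans : 'I_K -> A -> 'I_K -> R; (* trans s a s' is P(s' | s, a) *)
  reward : 'I_K -> A -> 'I_K -> R;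
  reward_bound : R;
  discount : R;
  trans_ge0 : forall s a s', 0 <= trans s a s';
  trans_sum1 : forall s a, \sum_s' trans s a s' = 1;
  reward_bounded : forall s a s', `|reward s a s'| <= reward_bound;
  discount_itv : 0 < discount < 1 }.

Section Policy.
Context (R : realType) (K : nat) (A : finType).
Variables (m : mdp R K A) (pol : 'I_K -> A).

Definition pol_trans : 'M[R]_K := \matrix_(s, s') trans m s (pol s) s'.

(* A trajectory of horizon T is (s_0, .., s_(T+1)); its t-th transition is
   from [traj_src tau t] = s_t to [traj_dst tau t] = s_(t+1), for t <= T. *)
Definition trajectory (T : nat) := {ffun 'I_T.+2 -> 'I_K}.

Definition traj_src T (tau : trajectory T) (t : 'I_T.+1) : 'I_K :=
  tau (widen_ord (leqnSn T.+1) t).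

Definition traj_dst T (tau : trajectory T) (t : 'I_T.+1) : 'I_K :=
  tau (lift ord0 t).

(* Probability of tau conditionally on its initial state. *)
Definition traj_prob T (tau : trajectory T) : R :=
  \prod_t pol_trans (traj_src tau t) (traj_dst tau t).

Definition traj_return T (tau : trajectory T) : R :=
  \sum_(t < T.+1) discount m ^+ t *
    reward m (traj_src tau t) (pol (traj_src tau t)) (traj_dst tau t).

Definition expected_return (s : 'I_K) (T : nat) : R :=
  \sum_(tau : trajectory T | tau ord0 == s) traj_prob tau * traj_return tau.

Definition value_fun (s : 'I_K) : R := limn (expected_return s).

Definition bellman (v : 'cV[R]_K) : 'cV[R]_K :=
  \col_s \sum_s' trans m s (pol s) s' *
    (reward m s (pol s) s' + discount m * v s' 0).

End Policy.

Section MarkovChain.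
Context (R : realType) (K : nat).
Implicit Types (P : 'M[R]_K) (xi : 'rV[R]_K).

Definition irreducible P := forall s s', exists n : nat, 0 < (P ^+ n) s s'.

(* The gcd of the possible return times of every state is 1. *)
Definition aperiodic P := forall s (d : nat),
  (forall n : nat, (0 < n)%N -> 0 < (P ^+ n) s s -> (d %| n)%N) -> d = 1%N.

Definition ergodic P := irreducible P /\ aperiodic P.

Definition steady_state P xi :=
  [/\ forall s, 0 < xi 0 s < 1, \sum_s xi 0 s = 1 & xi *m P = xi].

End MarkovChain.

Section Network.
Variable R : realType.

(* Number of parameters of an MLP with input width n, hidden widths hs and
   output width 1; an affine layer from width n to width h is a weight matrix
   of size (n + 1) * h whose last row is the bias. *)
Fixpoint nparams (n : nat) (hs : seq nat) : nat :=
  if hs is h :: hs' then ((n + 1) * h + nparams h hs')%N else ((n + 1) * 1)%N.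

Lemma nparamsE n hs :
  nparams n hs = (\sum_(1 <= l < (size hs).+2)
    (nth 0 (n :: rcons hs 1) l.-1 + 1) * nth 0 (n :: rcons hs 1) l)%N.
Proof.
elim: hs n => [|h hs IH] n; first by rewrite big_nat1.
rewrite big_ltn // [in RHS]big_add1 [LHS]/= IH.
by congr addn; rewrite !big_add1.
Qed.

Definition affine_layer n h (W : 'M[R]_((n + 1)%N, h)) (x : 'cV[R]_n) : 'cV[R]_h :=
  W^T *m col_mx x 1%:M.

(* The parameters of all layers are concatenated, first layer first, in a
   single row vector; each layer is vectorised by [mxvec]. *)
Fixpoint mlp_from (sigma : R -> R) (n : nat) (hs : seq nat) :
    'rV[R]_(nparams n hs) -> 'cV[R]_n -> R :=
  match hs return 'rV[R]_(nparams n hs) -> 'cV[R]_n -> R with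
  | [::] => fun W x => affine_layer (vec_mx W) x 0 0
  | h :: hs' => fun W x => mlp_from sigma (rsubmx W)
      (map_mx sigma (affine_layer (vec_mx (lsubmx W)) x))
  end.

Definition mlp sigma hs (W : 'rV[R]_(nparams 1 hs)) (x : R) : R :=
  mlp_from sigma W x%:M.

Definition smooth (sigma : R -> R) :=
  forall (n : nat) (x : R), derivable (derive1n n sigma) x 1.

Definition unbounded (sigma : R -> R) :=
  ~ exists B : R, forall x, `|sigma x| <= B.

Definition activation (sigma : R -> R) :=
  [/\ smooth sigma, unbounded sigma & {homo sigma : x y / x < y}].

End Network.

Section Calculus.
Context (R : realType) (N : nat).
Implicit Types (g : 'rV[R]_N -> R) (W : 'rV[R]_N).

Definition partial (j : 'I_N) g W : R := 'D_(delta_mx 0 j) g W.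

Definition gradient g W : 'rV[R]_N := \row_j partial j g W.

Definition hessian g W : 'M[R]_N := \matrix_(i, j) partial i (partial j g) W.

End Calculus.

Definition psd (R : realType) (N : nat) (H : 'M[R]_N) :=
  H^T = H /\ forall v : 'cV[R]_N, 0 <= (v^T *m H *m v) 0 0.

Section Loss.
Context (R : realType) (K : nat) (A : finType).
Variables (m : mdp R K A) (pol : 'I_K -> A) (xi : 'rV[R]_K).
Variables (sigma : R -> R) (hs : seq nat).
Implicit Type W : 'rV[R]_(nparams 1 hs).

Definition net_at (s : 'I_K) W : R := mlp sigma W (s.+1)%:R.

Definition net_vec W : 'cV[R]_K := \col_s net_at s W.

Definition residual W : 'cV[R]_K := net_vec W - bellman m pol (net_vec W).

Definition nmsbe W : R :=
  2^-1 * ((residual W)^T *m diag_mx xi *m residual W) 0 0.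

Definition net_jacobian W : 'M[R]_(K, nparams 1 hs) :=
  \matrix_s gradient (net_at s) W.

Definition bellman_mx : 'M[R]_K := 1%:M - discount m *: pol_trans m pol.

Definition approx_hessian W : 'M[R]_(nparams 1 hs) :=
  (net_jacobian W)^T *m bellman_mx^T *m diag_mx xi *m bellman_mx
    *m net_jacobian W.

(* The part of the Hessian of [nmsbe] that contains second derivatives of the
   network, weighted by the Bellman residual; [approx_hessian] omits it. *)
Definition second_order_term W : 'M[R]_(nparams 1 hs) :=
  \sum_s ((residual W)^T *m diag_mx xi *m bellman_mx) 0 s
    *: hessian (net_at s) W.

End Loss.

(* Main.v *)
(* The network is built from coordinates of the parameter vector by sums,
   products and the smooth activation, so all its iterated directional
   derivatives exist.
   The residual is an affine image of the network outputs, and differentiating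
   the weighted sum of its squares twice splits the Hessian into the
   Gauss-Newton part M^T diag(xi) M, with M = (I - gamma P) G having K rows,
   and the residual-weighted second derivatives. *)
Require Import Defs.
From mathcomp Require Import all_boot all_order all_algebra.
From mathcomp Require Import all_classical all_reals all_analysis.
Import Order.TTheory GRing.Theory Num.Theory.
Import numFieldNormedType.Exports.
Local Open Scope ring_scope.
Set Implicit Arguments.
Unset Strict Implicit.
Unset Printing Implicit Defensive.

(** * Iterated directional derivatives and their closure properties *)

Section DirectionalDerivatives.
Local Open Scope classical_set_scope.
Context (R : realType) (V : normedModType R).
Implicit Types (f g : V -> R) (x v : V) (s : R -> R) (k : nat).

(** Derivability along one direction does not make [g] differentiable on [V]. Restricted to the line
    [t *: v + x], however, [g] is a function of one real variable, where derivable and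
    differentiable agree and the usual chain rule applies. *)
Lemma is_derive_comp s g x v (ds dg : R) :
  is_derive (g x) 1 s ds -> is_derive x v g dg ->
  is_derive x v (s \o g) (ds * dg).
Proof.
move=> hs hg.
have lineE (h : V -> R) : derive h x v = derive (fun t : R => h (t *: v + x)) 0 1.
  rewrite /derive; set q := fun t => _; set q' := fun t => _.
  suff -> : q = q' by [].
  by apply/funext => t; rewrite /q /q' /= addr0 scale0r add0r [_%:A]mulr1.
have ds0 : derivable s (g (0 *: v + x)) 1 by rewrite scale0r add0r.
have dl0 : derivable (fun t : R => g (t *: v + x)) 0 1.
  by apply/(derivable1P g x v); case: hg.
split.
  apply/(derivable1P (s \o g) x v)/derivable1_diffP.
  apply: (@differentiable_comp _ _ _ _ (fun t : R => g (t *: v + x)) s);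
    exact/derivable1_diffP.
rewrite lineE -derive1E.
rewrite (_ : (fun t => _) = s \o (fun t : R => g (t *: v + x))) //.
rewrite derive1_comp // !derive1E -lineE scale0r add0r.
by rewrite !derive_val.
Qed.

(** Only directional derivatives are tracked, since [gradient] and [hessian] are built from them
    alone. The recursion on [k] lets each closure property follow by induction from the matching
    differentiation rule. *)
Fixpoint iter_derivable k g : Prop :=
  if k is k'.+1 then
    (forall x v, derivable g x v) /\
    forall v, iter_derivable k' (fun x => derive g x v)
  else True.

Lemma iter_derivableW k g : iter_derivable k.+1 g -> iter_derivable k g.
Proof.
elim: k g => // k IH g [dg Dg]; split=> // v.
exact/IH/Dg.
Qed.

(** Lets an inductive step work on an explicit formula [dg] for the derivative. *)
Lemma iter_derivableS k g (dg : V -> V -> R) :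
  (forall x v, is_derive x v g (dg v x)) ->
  (forall v, iter_derivable k (dg v)) -> iter_derivable k.+1 g.
Proof.
move=> D Dg; split=> [x v|v]; first by case: (D x v).
suff -> : (fun x => derive g x v) = dg v by exact: Dg.
by apply/funext => x; case: (D x v).
Qed.

Lemma iter_derivable_cst k (a : R) : iter_derivable k (fun=> a).
Proof.
elim: k a => // k IH a.
exact: (@iter_derivableS _ _ (fun _ _ => 0)).
Qed.

Lemma iter_derivableD k f g : iter_derivable k f -> iter_derivable k g ->
  iter_derivable k (fun x => f x + g x).
Proof.
elim: k f g => // k IH f g [df Df] [dg Dg].
apply: (@iter_derivableS _ _ (fun v x => derive f x v + derive g x v)).
  by move=> x v; apply: is_deriveD; exact/derivableP.
by move=> v; exact: IH (Df v) (Dg v).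
Qed.

Lemma iter_derivableM k f g : iter_derivable k f -> iter_derivable k g ->
  iter_derivable k (fun x => f x * g x).
Proof.
elim: k f g => // k IH f g cf cg.
have [[df Df] [dg Dg]] := (cf, cg).
apply: (@iter_derivableS _ _
  (fun v x => f x * derive g x v + g x * derive f x v)).
  by move=> x v; apply: is_deriveM; exact/derivableP.
move=> v; apply: iter_derivableD; apply: IH.
- exact: iter_derivableW cf.
- exact: Dg.
- exact: iter_derivableW cg.
- exact: Df.
Qed.

Lemma iter_derivable_sum k (I : Type) (r : seq I) (f : I -> V -> R) :
  (forall i, iter_derivable k (f i)) ->
  iter_derivable k (fun x => \sum_(i <- r) f i x).
Proof.
move=> cf; elim: r => [|i r IH].
  by under eq_fun do rewrite big_nil; exact: iter_derivable_cst.
by under eq_fun do rewrite big_cons; exact: iter_derivableD.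
Qed.

Lemma smooth_derive1 s : smooth s -> smooth (derive1 s).
Proof. by move=> ss n x; rewrite -derive1Sn; exact: ss. Qed.

(** The chain rule produces [derive1 s] composed with [g], so the induction on [k] must range over
    all smooth outer functions. *)
Lemma iter_derivable_comp k s g : smooth s -> iter_derivable k g ->
  iter_derivable k (fun x => s (g x)).
Proof.
elim: k s g => // k IH s g ss cg; have [dg Dg] := cg.
apply: (@iter_derivableS _ _ (fun v x => derive1 s (g x) * derive g x v)).
  move=> x v; apply: is_derive_comp; last exact: (derivableP (dg x v)).
  by rewrite derive1E; exact: (derivableP (ss 0%N (g x))).
move=> v; apply: iter_derivableM (Dg v).
exact: IH (smooth_derive1 ss) (iter_derivableW cg).
Qed.

End DirectionalDerivatives.

(** * Regularity of the network in its parameters *)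

Section NetworkDerivatives.
Local Open Scope classical_set_scope.
Context (R : realType) (N : nat) (sigma : R -> R).
Hypothesis sigma_smooth : smooth sigma.

Lemma iter_derivable_coord k (j : 'I_N) :
  iter_derivable k (fun W : 'rV[R]_N => W 0 j).
Proof.
have D (x v : 'rV[R]_N) : is_derive x v (fun W : 'rV[R]_N => W 0 j) (v 0 j).
  pose F (h : R) := h^-1 *: (((fun W : 'rV[R]_N => W 0 j) \o shift x) (h *: v) - x 0 j).
  have cF : F h @[h --> 0^'] --> v 0 j.
    (* A coordinate is linear, so its difference quotient equals [v 0 j] for every nonzero [h]. *)
    apply: cvg_near_cst; near=> h.
    rewrite /F /= !mxE addrK [_ *: _]mulrA mulVf ?mul1r //.
    by near: h; exact: nbhs_dnbhs_neq.
  by split; [apply/cvg_ex; exists (v 0 j)|exact: cvg_lim cF].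
case: k => // k; apply: (@iter_derivableS _ _ _ _ (fun v _ : 'rV[R]_N => v 0 j)) => // v.
exact: iter_derivable_cst.
Unshelve. all: by end_near.
Qed.

Lemma iter_derivable_affine k n h (U : 'rV[R]_N -> 'rV[R]_((n + 1) * h))
    (x : 'rV[R]_N -> 'cV[R]_n) (i : 'I_h) :
  (forall j, iter_derivable k (fun W => U W 0 j)) ->
  (forall j, iter_derivable k (fun W => x W j 0)) ->
  iter_derivable k (fun W => affine_layer (vec_mx (U W)) (x W) i 0).
Proof.
move=> cU cx; rewrite /affine_layer.
under eq_fun do rewrite mxE.
apply: iter_derivable_sum => j; apply: iter_derivableM.
  by under eq_fun do rewrite !mxE; exact: cU.
under eq_fun do rewrite mxE.
case: (fintype.split j) => l; first exact: cx.
exact: iter_derivable_cst.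
Qed.

(** Both the remaining parameters and the layer input vary with [W]: past the first layer the input
    depends on the weights already consumed, so the induction on [hs] needs this generality. *)
Lemma iter_derivable_mlp_from k n hs (U : 'rV[R]_N -> 'rV[R]_(nparams n hs))
    (x : 'rV[R]_N -> 'cV[R]_n) :
  (forall j, iter_derivable k (fun W => U W 0 j)) ->
  (forall j, iter_derivable k (fun W => x W j 0)) ->
  iter_derivable k (fun W => mlp_from sigma (U W) (x W)).
Proof.
elim: hs n U x => [|h hs IH] n U x cU cx /=; first exact: iter_derivable_affine.
apply: IH => j; first by under eq_fun do rewrite mxE; exact: cU.
under eq_fun do rewrite mxE.
apply: iter_derivable_comp => //; apply: iter_derivable_affine => // l.
by under eq_fun do rewrite mxE; exact: cU.
Qed.

End NetworkDerivatives.

Lemma iter_derivable_net_at (R : realType) K (sigma : R -> R) hs (s : 'I_K) k :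
  smooth sigma -> iter_derivable k (net_at sigma (hs := hs) s).
Proof.
move=> ss; apply: (@iter_derivable_mlp_from _ _ _ ss k 1 hs id
  (fun=> (s.+1%:R)%:M)) => j.
  exact: iter_derivable_coord.
exact: iter_derivable_cst.
Qed.

(** * First and second partial derivatives of a weighted half sum of squares *)

Section SumOfSquares.
Context (R : realType) (N K : nat).
Variables (c : 'I_K -> R) (d : 'I_K -> 'rV[R]_N -> R).
Hypothesis d_derivable : forall s, iter_derivable 2 (d s).
Implicit Type W : 'rV[R]_N.

Lemma is_derive_sum_fun n (f : 'I_n -> 'rV[R]_N -> R) (df : 'I_n -> R) W v :
  (forall i, is_derive W v (f i) (df i)) ->
  is_derive W v (fun x => \sum_i f i x) (\sum_i df i).
Proof.
move=> D; rewrite (_ : (fun x => _) = \sum_i f i); first exact: is_derive_sum.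
by apply/funext => x; rewrite fct_sumE.
Qed.

Lemma partial_half_sum_sq j :
  partial j (fun W => 2^-1 * \sum_s c s * (d s W * d s W)) =
  (fun W => \sum_s c s * (d s W * partial j (d s) W)).
Proof.
apply/funext => W; apply: derive_val.
have D : is_derive W (delta_mx 0 j) (fun W => \sum_s c s * (d s W * d s W))
    (\sum_s c s * (d s W * partial j (d s) W + d s W * partial j (d s) W)).
  apply: is_derive_sum_fun => s; apply: is_deriveZ; apply: is_deriveM;
    apply/derivableP; exact: (d_derivable s).1.
apply: (@is_derive_eq _ _ _ _ _ _ _ _ (is_deriveZ 2^-1 D)).
rewrite [_ *: _]mulr_sumr; apply: eq_bigr => s _.
(* The two equal product-rule terms cancel the factor 1/2. *)
by rewrite -mulr2n mulrCA -[_ * _ *+ 2]mulr_natl mulKf ?pnatr_eq0.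
Qed.

Lemma partial2_half_sum_sq i j W :
  partial i (partial j (fun W => 2^-1 * \sum_s c s * (d s W * d s W))) W =
  \sum_s c s * (d s W * partial i (partial j (d s)) W
                + partial j (d s) W * partial i (d s) W).
Proof.
rewrite partial_half_sum_sq; apply: derive_val.
apply: is_derive_sum_fun => s; apply: is_deriveZ.
apply: (@is_deriveM _ _ (d s) (partial j (d s))); apply/derivableP.
  exact: (d_derivable s).1.
exact: ((d_derivable s).2 (delta_mx 0 j)).1.
Qed.

End SumOfSquares.

(** * Hessian of the loss *)

Section LossDerivatives.
Context (R : realType) (K : nat) (A : finType).
Variables (m : mdp R K A) (pol : 'I_K -> A) (xi : 'rV[R]_K).
Variables (sigma : R -> R) (hs : seq nat).
Hypothesis sigma_smooth : smooth sigma.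
Implicit Types (W : 'rV[R]_(nparams 1 hs)) (s : 'I_K).

Let B := bellman_mx m pol.
Let resid s W := residual m pol sigma W s 0.

(** The expected reward does not depend on [W], so the residual is affine in the network outputs.
    Differentiation removes [b], whose value is therefore left existential. *)
Lemma residualE s : exists b : R,
  resid s = fun W => \sum_s' B s s' * net_at sigma s' W - b.
Proof.
exists (\sum_s' trans m s (pol s) s' * reward m s (pol s) s').
apply/funext => W; rewrite /resid /residual !mxE.
(* Split [B] into its identity and transition parts; the Kronecker sum then collapses to the single
   output at [s]. *)
rewrite [X in _ = X - _](eq_bigr (fun s' => (s == s')%:R * net_at sigma s' W
    - discount m * (trans m s (pol s) s' * net_at sigma s' W))); last first.
  by move=> s' _; rewrite /B !mxE mulrBl mulrA.
rewrite [in RHS]sumrB [\sum_i (s == i)%:R * _](bigD1 s) //= eqxx mul1r.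
rewrite [X in _ = _ + X - _ - _]big1 ?addr0; last first.
  by move=> s' /negPf ne; rewrite eq_sym ne mul0r.
rewrite -addrA -opprD -big_split /=; congr (_ - _).
by apply: eq_bigr => s' _; rewrite !mxE mulrDr [RHS]addrC mulrCA.
Qed.

Lemma iter_derivable_resid s k : iter_derivable k (resid s).
Proof.
have [b ->] := residualE s.
apply: iter_derivableD; last exact: iter_derivable_cst.
apply: iter_derivable_sum => s'; apply: iter_derivableM.
  exact: iter_derivable_cst.
exact: iter_derivable_net_at.
Qed.

Lemma partial_resid s j :
  partial j (resid s) = fun W => \sum_s' B s s' * partial j (net_at sigma s') W.
Proof.
have [b ->] := residualE s; apply/funext => W; apply: derive_val.
rewrite -[X in is_derive _ _ _ X]subr0; apply: is_deriveB.
apply: is_derive_sum_fun => s'; apply: is_deriveZ; apply: derivableP.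
exact: (iter_derivable_net_at hs s' 1 sigma_smooth).1.
Qed.

Lemma partial2_resid s i j W : partial i (partial j (resid s)) W =
  \sum_s' B s s' * partial i (partial j (net_at sigma s')) W.
Proof.
rewrite partial_resid; apply: derive_val.
apply: is_derive_sum_fun => s'; apply: is_deriveZ; apply: derivableP.
exact: ((iter_derivable_net_at hs s' 2 sigma_smooth).2 (delta_mx 0 j)).1.
Qed.

Lemma nmsbeE : nmsbe m pol xi sigma (hs := hs) =
  fun W => 2^-1 * \sum_s xi 0 s * (resid s W * resid s W).
Proof.
apply/funext => W; rewrite /nmsbe; congr (_ * _).
rewrite -mulmxA mul_diag_mx mxE; apply: eq_bigr => s _.
by rewrite [_^T _ _]mxE [X in _ * X]mxE mulrCA.
Qed.

(** In the second partials of the sum of squares, products of first partials form the Gauss-Newton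
    matrix, and residuals times second partials form the remainder. *)
Lemma hessian_nmsbe W : hessian (nmsbe m pol xi sigma (hs := hs)) W =
  approx_hessian m pol xi sigma W + second_order_term m pol xi sigma W.
Proof.
apply/matrixP => i j; rewrite mxE nmsbeE partial2_half_sum_sq; last first.
  by move=> s; exact: iter_derivable_resid.
under eq_bigr do rewrite mulrDr.
rewrite big_split /= addrC [RHS]mxE; congr (_ + _).
  rewrite /approx_hessian -/B -!mulmxA mulmxA -trmx_mul mul_diag_mx mxE.
  apply: eq_bigr => s _; rewrite !mxE.
  have JE l : partial l (resid s) W = (B *m net_jacobian K sigma W) s l.
    by rewrite partial_resid !mxE; apply: eq_bigr => s' _; rewrite !mxE.
  by rewrite !JE !mxE [RHS]mulrCA; congr (_ * _); exact: mulrC.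
rewrite /second_order_term -/B summxE.
under eq_bigr do rewrite partial2_resid mulr_sumr mulr_sumr.
(* With the sum over network outputs outermost, the inner sum is the weight of that output's
   Hessian. *)
rewrite exchange_big /=; apply: eq_bigr => s' _.
rewrite 2!mxE mulr_suml; apply: eq_bigr => s _.
rewrite mul_mx_diag [in RHS]mxE [hessian _ _ _ _]mxE [_^T _ _]mxE.
by rewrite !mulrA [xi 0 s * _]mulrC.
Qed.

End LossDerivatives.

(** The quadratic form at [v] is the sum of the squared entries of [M *m v], weighted by [d]. *)
Lemma psd_congruence_diag (R : realType) (K N : nat) (d : 'rV[R]_K)
    (M : 'M[R]_(K, N)) :
  (forall s, 0 <= d 0 s) -> psd (M^T *m diag_mx d *m M).
Proof.
move=> d0; split; first by rewrite !trmx_mul trmxK tr_diag_mx mulmxA.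
move=> v; rewrite !mulmxA -trmx_mul -2!mulmxA mul_diag_mx mxE.
apply: sumr_ge0 => s _; rewrite !mxE mulrCA.
by rewrite mulr_ge0 // -expr2 sqr_ge0.
Qed.

(** Semi-definiteness and the rank bound concern the approximated Hessian [H]; the first conjunct
    makes its difference from the true Hessian explicit. *)
Theorem proposition2 (R : realType) (K : nat) (A : finType)
    (m : mdp R K A) (pol : 'I_K -> A) (xi : 'rV[R]_K)
    (Herg : ergodic (pol_trans m pol))
    (Hxi : steady_state (pol_trans m pol) xi)
    (sigma : R -> R) (Hsigma : activation sigma)
    (hs : seq nat) (Hhs : all (fun h => 0 < h)%N hs)
    (Hrepr : exists W0 : 'rV[R]_(nparams 1 hs),
       forall s : 'I_K, mlp sigma W0 (s.+1)%:R = value_fun m pol s)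
    (W : 'rV[R]_(nparams 1 hs))
    (Hcrit : gradient (nmsbe m pol xi sigma (hs := hs)) W = 0) :
  let H := approx_hessian m pol xi sigma W in
  [/\ hessian (nmsbe m pol xi sigma (hs := hs)) W
        = H + second_order_term m pol xi sigma W,
      psd H
    & (K <= nparams 1 hs)%N -> (\rank H <= K)%N].
Proof.
move=> H; split.
- by apply: hessian_nmsbe; case: Hsigma.
- rewrite /H /approx_hessian -mulmxA -trmx_mul.
  apply: psd_congruence_diag => s.
  by case: Hxi => /(_ s) /andP[/ltW].
(* The last factor of [H] is the network Jacobian, which has [K] rows. *)
- by move=> _; exact: leq_trans (mxrankM_maxr _ _) (rank_leq_row _).
Qed.
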